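(* Let $n\ge2$, $X=\mathbb{R}^m$ with a norm, and let $A:X\to X$ be linear such that: (1) there are $A$-invariant subspaces with $X=X_c\oplus X_u\oplus X_s$; write $A_i=A|_{X_i}$ for $i=c,u,s$; (1a) $\|x\|=\max\{\|x_c\|_c,\|x_u\|_u,\|x_s\|_s\}$ for $x=(x_c,x_u,x_s)$, with $\|\cdot\|_i$ the norm on $X_i$; (2) $A_c$ and $A_u$ are invertible; (3) $\|A_c^{-1}\|_{\mathrm{op}}^{\tilde n}\|A_s\|_{\mathrm{op}}<1$ and $\|A_u^{-1}\|_{\mathrm{op}}\|A_c\|_{\mathrm{op}}^{\tilde n}<1$ for all $1\le\tilde n\le n$. Then there is $\delta>0$, depending only on $n$, the normed space $X$ with its splitting, and $A$, such that the following holds for all $L_g,L_c\in(0,\delta]$. Let $F=A+g:X\to X$ be $C^n$ with $g\in C^n_b(X,X)$, $g(0)=0$, $Dg(0)=0$, $\|Dg\|_0<L_g$, and let $k_c\in C^n_b(X_c,X_c)$ with $k_c(0)=0$, $Dk_c(0)=0$, $\|Dk_c\|_0<L_c$. Let $K:X_c\to X$ and $R:X_c\to X_c$ be the $C^n$ conjugacy and conjugate dynamical system given by the parameterization theorem for center manifolds applied to $F$ and $k_c$. Let $P_R$ and $P_K$ be the Taylor expansions at $0$ of $R$ and $K$ of order $n-1$. Then there exists a neighborhood $\mathcal{U}$ of $0$ in $X_c$ such that for every neighborhood $U\subset\mathcal{U}$ of $0$ there exist constants $C_R$ and $C_K$ such that $$\|R(x)-P_R(x)\|\le C_R\|x\|^n\qquad\text{and}\qquad\|K(x)-P_K(x)\|\le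 C_K\|x\|^n\qquad\text{for all }x\in U .$$
   Context: $C^n_b(X,Y)$ is the space of $C^n$ maps $f:X\to Y$ with $\max_{0\le m\le n}\sup_x\|D^mf(x)\|<\infty$; $\|Dh\|_0=\sup_x\|Dh(x)\|_{\mathrm{op}}$. Parameterization theorem for center manifolds (known): for $A$, $F=A+g$ and $k_c$ as in the claim, with $L_g,L_c$ small enough (depending only on $n$ and the linear data), there exist $C^n$ maps $K=\iota+(k_c,k_u,k_s):X_c\to X$ ($\iota:X_c\to X$ the inclusion, $k_u:X_c\to X_u$, $k_s:X_c\to X_s$) and $R=A_c+r:X_c\to X_c$, with $R$ globally invertible, such that $F\circ K=K\circ R$. They are unique subject to $k_u,k_s,r$ being bounded and continuous and $R$ being a homeomorphism. *)

(* Defs.v *)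
From HB Require Import structures.
From mathcomp Require Import all_boot all_order all_algebra.
From mathcomp Require Import all_classical all_reals all_analysis.

Set Implicit Arguments.
Unset Strict Implicit.
Unset Printing Implicit Defensive.

Import Order.TTheory GRing.Theory Num.Theory.
Import numFieldNormedType.Exports VectorInternalTheory.

Local Open Scope classical_set_scope.
Local Open Scope ring_scope.

(* A finite-dimensional normed space: [R ^ m] with an arbitrary norm. *)
#[short(type="finNormedModType")]
HB.structure Definition FinNormedModule (R : numFieldType) :=
  {V of NormedModule R V & Vector R V}.

HB.instance Definition _ (R : numFieldType) m n :=
  Vector.on 'M[R]_(m, n).

(* A subspace carries the restricted norm. *)
Section subspace.
Variables (R : realType) (X : finNormedModType R) (U : {vspace X}).

Let subvs_norm (u : subvs_of U) : R := `|vsval u|.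

Fact ler_subvs_normD u v :
  subvs_norm (u + v) <= subvs_norm u + subvs_norm v.
Proof. exact: ler_normD. Qed.

Fact subvs_normZ l u : subvs_norm (l *: u) = `|l| * subvs_norm u.
Proof. by rewrite /subvs_norm linearZ/= normrZ. Qed.

Fact subvs_norm_eq0 u : subvs_norm u = 0 -> u = 0.
Proof. by move/normr0_eq0 => u0; apply: val_inj; rewrite /= u0. Qed.

HB.instance Definition _ := Lmodule_isNormed.Build R (subvs_of U)
  ler_subvs_normD subvs_normZ subvs_norm_eq0.

End subspace.

(* ['Hom(X, Y)] carries the operator norm; the supremum is finite because a
   linear map out of a finite-dimensional normed space is bounded. *)
Section operator_norm.
Variables (R : realType) (X Y : finNormedModType R).

Definition opnorm (f : 'Hom(X, Y)) : R :=
  sup [set `|f x| | x in [set x : X | `|x| <= 1]].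

Let rV_bounded n (Z : normedModType R) (h : {linear 'rV[R]_n -> Z}) :
  exists2 M, 0 <= M & forall r, `|h r| <= M * `|r|.
Proof.
exists (\sum_i `|h (delta_mx 0 i)|); first exact: sumr_ge0.
move=> r; rewrite {1}(row_sum_delta r) linear_sum/=.
rewrite (le_trans (ler_norm_sum _ _ _))// mulr_suml ler_sum// => i _.
rewrite linearZ/= normrZ mulrC ler_wpM2l//.
rewrite [leRHS]/Num.norm/= mx_normrE.
exact: (le_bigmax_cond 0 (fun ij : 'I_1 * 'I_n => `|r ij.1 ij.2|) (j := (0, i))).
Qed.

Let v2r_bounded : exists2 M, 0 <= M & forall x : X, `|v2r x| <= M * `|x|.
Proof.
have [M M0 HM] := rV_bounded (@r2v R X).
pose S := [set r : 'rV[R]_(dim X) | `|r| = 1].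
have [[s0 Ss0]|S0] := pselect (S !=set0); last first.
  exists 0 => // x; rewrite mul0r; have [->|x0] := eqVneq (v2r x) 0.
    by rewrite normr0.
  by case: S0; exists (`|v2r x|^-1 *: v2r x); rewrite /S/= normfZV.
have cn : continuous (fun r : 'rV[R]_(dim X) => `|r2v r| : R).
  move=> r; apply: continuous_comp; last exact: norm_continuous.
  apply: bounded_linear_continuous; apply/bounded_funP => k.
  by exists (M * k) => y yk; rewrite (le_trans (HM _))// ler_wpM2l.
have cS : compact S.
  apply: bounded_closed_compact.
    by exists 1; split => // y y1 r /= ->; exact: ltW.
  have -> : S = (fun r : 'rV[R]_(dim X) => `|r| : R) @^-1` [set (1 : R)] by [].
  apply: preimage_closed; last exact: closed_eq.
  by move=> r _; exact: norm_continuous.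
have [c Sc cmin] := compact_EVT_min (ex_intro _ s0 Ss0) cS
  (continuous_subspaceT cn).
have c0 : 0 < `|r2v c|.
  rewrite normr_gt0; apply/eqP => c0.
  have := Sc; rewrite inE /S /= -(r2vK c) c0 linear0 normr0 => /eqP.
  by rewrite eq_sym oner_eq0.
exists (`|r2v c|^-1); first by rewrite invr_ge0.
move=> x; have [->|x0] := eqVneq (v2r x) 0; first by rewrite normr0 mulr_ge0.
have : `|r2v c| <= `|r2v (`|v2r x|^-1 *: v2r x)|.
  by apply: cmin; rewrite inE /S /= normfZV.
rewrite linearZ/= v2rK normrZ normfV normr_id.
by rewrite ler_pdivlMl ?normr_gt0// ler_pdivlMl// mulrC.
Qed.

Lemma lfun_bounded (f : 'Hom(X, Y)) :
  exists2 M, 0 <= M & forall x, `|f x| <= M * `|x|.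
Proof.
have [M M0 HM] := v2r_bounded.
have [N N0 HN] := rV_bounded (f \o @r2v R X).
exists (N * M) => [|x]; first exact: mulr_ge0.
by rewrite -{1}(v2rK x) (le_trans (HN _))// -mulrA ler_wpM2l.
Qed.

Let opnorm_has_sup (f : 'Hom(X, Y)) :
  has_sup [set `|f x| | x in [set x : X | `|x| <= 1]].
Proof.
split; first by exists `|f 0|, 0 => //=; rewrite normr0.
have [M M0 HM] := lfun_bounded f; exists M => _ [x /= x1 <-].
by rewrite (le_trans (HM x))// -[leRHS]mulr1 ler_wpM2l.
Qed.

Lemma opnormP (f : 'Hom(X, Y)) x : `|f x| <= opnorm f * `|x|.
Proof.
have [->|x0] := eqVneq x 0; first by rewrite linear0 !normr0 mulr0.
rewrite mulrC -ler_pdivrMl ?normr_gt0// -{1}[`|x|]normr_id -normfV -normrZ -linearZ.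
by apply: ub_le_sup; [case: (opnorm_has_sup f) | exists (`|x|^-1 *: x) => //=; rewrite normfZV].
Qed.

Lemma opnorm_le (f : 'Hom(X, Y)) M :
  (forall x, `|x| <= 1 -> `|f x| <= M) -> opnorm f <= M.
Proof.
move=> fM; apply: ge_sup; first by case: (opnorm_has_sup f).
by move=> _ [x /= x1 <-]; exact: fM.
Qed.

Lemma opnorm_ge0 f : 0 <= opnorm f.
Proof.
apply: ub_le_sup; first by case: (opnorm_has_sup f).
by exists 0 => /=; rewrite ?linear0 normr0.
Qed.

Fact ler_opnormD f g : opnorm (f + g) <= opnorm f + opnorm g.
Proof.
apply: opnorm_le => x x1; rewrite add_lfunE (le_trans (ler_normD _ _))//.
by apply: lerD; rewrite (le_trans (opnormP _ _))// -[leRHS]mulr1 ler_wpM2l ?opnorm_ge0.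
Qed.

Fact opnormZ l f : opnorm (l *: f) = `|l| * opnorm f.
Proof.
have leZ k g : opnorm (k *: g) <= `|k| * opnorm g.
  apply: opnorm_le => x x1; rewrite scale_lfunE normrZ ler_wpM2l//.
  by rewrite (le_trans (opnormP _ _))// -[leRHS]mulr1 ler_wpM2l ?opnorm_ge0.
apply/eqP; rewrite eq_le leZ/=.
have [->|l0] := eqVneq l 0; first by rewrite normr0 mul0r opnorm_ge0.
rewrite -ler_pdivlMl ?normr_gt0// -normfV -{1}[f](scalerK l0); exact: leZ.
Qed.

Fact opnorm_eq0 f : opnorm f = 0 -> f = 0.
Proof.
move=> f0; apply/lfunP => x; rewrite zero_lfunE; apply/normr0_eq0/eqP.
by rewrite eq_le normr_ge0 andbT (le_trans (opnormP f x))// f0 mul0r.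
Qed.

HB.instance Definition _ := Lmodule_isNormed.Build R 'Hom(X, Y)
  ler_opnormD opnormZ opnorm_eq0.

End operator_norm.

Section higher_derivatives.
Variables (R : realType) (X : finNormedModType R).

Definition Dfun (Y : finNormedModType R) (f : X -> Y) : X -> 'Hom(X, Y) :=
  fun x => linfun ('d f x).

(* [multihom k Y] is [L(X, L(X, ... L(X, Y)))], with [k] copies of [X]; its
   (iterated operator) norm is the norm of [k]-linear maps. *)
Fixpoint multihom (k : nat) (Y : finNormedModType R) : finNormedModType R :=
  if k is k'.+1 then multihom k' 'Hom(X, Y) else Y.

(* The value of a [k]-linear map at [(x, ..., x)]. *)
Fixpoint multihom_diag (k : nat) (Y : finNormedModType R) (x : X) :
    multihom k Y -> Y :=
  if k is k'.+1 then fun T => multihom_diag (k := k') x T x else fun T => T.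

Fixpoint Diter (k : nat) (Y : finNormedModType R) (f : X -> Y) :
    X -> multihom k Y :=
  if k is k'.+1 then Diter k' (Dfun f) else f.

Fixpoint isCn (n : nat) (Y : finNormedModType R) (f : X -> Y) : Prop :=
  if n is n'.+1 then (forall x, differentiable f x) /\ isCn n' (Dfun f)
  else continuous f.

Definition isCnb (n : nat) (Y : finNormedModType R) (f : X -> Y) : Prop :=
  isCn n f /\
  forall k, (k <= n)%N -> bounded_fun (Diter k f : X -> multihom k Y).

Definition Dnorm0 (Y : finNormedModType R) (f : X -> Y) : \bar R :=
  ereal_sup [set (`|Dfun f x|)%:E | x in [set: X]].

Definition taylor (N : nat) (Y : finNormedModType R) (f : X -> Y) (x : X) : Y :=
  \sum_(k < N.+1) (k`!%:R)^-1 *: multihom_diag x (Diter k f 0).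

End higher_derivatives.

Section center_manifold.
Variables (R : realType) (X : finNormedModType R).

(* The restriction of [A] to [U] when [U] is [A]-invariant; otherwise [vsproj]
   cuts the image down to [U]. *)
Definition lrestr (A : 'End(X)) (U : {vspace X}) : 'End(subvs_of U) :=
  linfun (vsproj U \o A \o vsval).

Definition is_max_norm (Xc Xu Xs : {vspace X}) : Prop :=
  forall (xc : subvs_of Xc) (xu : subvs_of Xu) (xs : subvs_of Xs),
    `|vsval xc + vsval xu + vsval xs| =
    Num.max (Num.max `|xc| `|xu|) `|xs|.

Record center_splitting (n : nat) (A : 'End(X)) (Xc Xu Xs : {vspace X}) :
    Prop := CenterSplitting {
  invariant_c : (A @: Xc <= Xc)%VS;
  invariant_u : (A @: Xu <= Xu)%VS;
  invariant_s : (A @: Xs <= Xs)%VS;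
  splitting_full : (Xc + Xu + Xs = fullv)%VS;
  splitting_direct : directv (Xc + Xu + Xs);
  splitting_norm : is_max_norm Xc Xu Xs;
  bijective_c : bijective (lrestr A Xc);
  bijective_u : bijective (lrestr A Xu);
  spectral_gap_s : forall k, (1 <= k <= n)%N ->
    `|(lrestr A Xc)^-1%VF| ^+ k * `|lrestr A Xs| < 1;
  spectral_gap_u : forall k, (1 <= k <= n)%N ->
    `|(lrestr A Xu)^-1%VF| * `|lrestr A Xc| ^+ k < 1
}.

(* [(K, R)] is the pair given by the parameterization theorem for [F] and [kc]:
   [K = iota + (kc, ku, ks)] and [R = A_c + r] are [C^n], [F o K = K o R], and
   they lie in the class in which that theorem asserts uniqueness, namely [ku],
   [ks] and [r] bounded and continuous and [R] a homeomorphism. *)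
Record center_conjugacy (n : nat) (A : 'End(X)) (Xc Xu Xs : {vspace X})
    (F : X -> X) (kc : subvs_of Xc -> subvs_of Xc)
    (K : subvs_of Xc -> X) (Rc : subvs_of Xc -> subvs_of Xc) : Prop :=
    CenterConjugacy {
  conjugacy_Cn : isCn n K;
  conjugate_Cn : isCn n Rc;
  conjugacy_form : exists (ku : subvs_of Xc -> subvs_of Xu)
                          (ks : subvs_of Xc -> subvs_of Xs),
    [/\ continuous ku, continuous ks, bounded_fun ku, bounded_fun ks &
        forall x, K x =
          vsval x + (vsval (kc x) + vsval (ku x) + vsval (ks x))];
  conjugate_form : exists r : subvs_of Xc -> subvs_of Xc,
    [/\ continuous r, bounded_fun r & forall x, Rc x = lrestr A Xc x + r x];
  conjugate_homeo : exists Rinv : subvs_of Xc -> subvs_of Xc,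
    [/\ continuous Rc, continuous Rinv, cancel Rc Rinv & cancel Rinv Rc];
  conjugacy_eq : forall x, F (K x) = K (Rc x)
}.

End center_manifold.

(* Main.v *)
Require Import Defs.
From HB Require Import structures.
From mathcomp Require Import all_boot all_order all_algebra.
From mathcomp Require Import all_classical all_reals all_analysis.

Set Implicit Arguments.
Unset Strict Implicit.
Unset Printing Implicit Defensive.

Import Order.TTheory GRing.Theory Num.Theory.
Import numFieldNormedType.Exports.

Local Open Scope classical_set_scope.
Local Open Scope ring_scope.

(** The conjugacy [K] and the dynamics [Rc] are [C^n], so both estimates are
Taylor's formula with an [O(|x|^n)] remainder, for [C^n] maps between
finite-dimensional normed spaces; the constants come from bounds on the [n]-th
derivatives near [0].

The formula is proved by induction on [n], simultaneously for all target spaces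
([taylor_remainder_bound]). Along the ray [t |-> t *: x] the remainder of order
[n + 1] of [f] has, as derivative, the remainder of order [n] of [Df] evaluated
on the vector [x] ([is_derive_taylor_remainder]). By induction the latter is at
most [C |t x|^n |x|], hence at most [C |x|^(n + 1)] for [t] in [[0, 1]], and the
mean value inequality concludes, since the remainder vanishes at [0].
On a ray only the values of the derivatives of [f] on the diagonal
[(x, ..., x)] occur, and the [(k + 1)]-st derivative of [f] is the [k]-th
derivative of [Df], so the Taylor terms of [f] and [Df] match one by one. *)

(** The scalars as a finite-dimensional normed space, so that linear forms have an
operator norm. *)
HB.instance Definition _ (R : realType) := Vector.on R^o.

Section differentiation.
Variable R : realType.

Lemma lfun_continuous (Y Z : finNormedModType R) (L : 'Hom(Y, Z)) :
  continuous L.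
Proof.
have [M M0 LM] := lfun_bounded L.
apply: bounded_linear_continuous; apply/bounded_funP => k.
by exists (M * k) => y yk; rewrite (le_trans (LM _))// ler_wpM2l.
Qed.

Lemma is_derive_lfun (V : normedModType R) (Y Z : finNormedModType R)
    (L : 'Hom(Y, Z)) (h : V -> Y) (a v : V) (d : Y) :
  is_derive a v h d -> is_derive a v (L \o h) (L d).
Proof.
move=> [dh <-].
have Lh : (fun e : R => e^-1 *: (((L \o h) \o shift a) (e *: v) - (L \o h) a))
    @ 0^' --> L ('D_v h a).
  rewrite [X in X @ _](_ : _ =
    L \o (fun e : R => e^-1 *: ((h \o shift a) (e *: v) - h a))); last first.
    by apply/funext => e /=; rewrite linearZ; congr (_ *: _); rewrite linearB.
  by apply: (cvg_comp _ _ dh); exact: lfun_continuous.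
by split; [apply/cvg_ex; exists (L ('D_v h a))|exact: (cvg_lim _ Lh)].
Qed.

(** The difference quotient of [f] along the ray is its difference quotient in
the direction [x]. *)
Lemma is_derive_ray (X Y : finNormedModType R) (f : X -> Y) (x : X) (t : R) :
  differentiable f (t *: x) ->
  is_derive t 1 (fun s : R => f (s *: x)) (Dfun f (t *: x) x).
Proof.
move=> df.
have quotE : (fun e : R =>
      e^-1 *: (((fun s : R => f (s *: x)) \o shift t) (e *: 1) - f (t *: x))) =
    (fun e => e^-1 *: ((f \o shift (t *: x)) (e *: x) - f (t *: x))).
  by apply/funext => e /=; rewrite -scalerDl [e *: 1]mulr1.
split; first by rewrite /derivable quotE; exact: diff_derivable.
by rewrite /Dfun lfunE /= -deriveE// /derive quotE.
Qed.

(** Multiplication of a fixed vector by a scalar is linear in the scalar, which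
reduces the derivative to that of a real power. *)
Lemma is_derive_expZ (Y : finNormedModType R) (c : Y) k (t : R) :
  is_derive t 1 (fun s : R => s ^+ k *: c) ((k%:R * t ^+ k.-1) *: c).
Proof.
have lin : linear (fun s : R^o => s *: c).
  by move=> a s u; rewrite scalerDl scalerA.
pose scaleM := GRing.isLinear.Build _ _ _ _ _ lin.
pose scaleL : {linear R^o -> Y} := HB.pack (fun s : R^o => s *: c) scaleM.
have -> : (fun s : R => s ^+ k *: c) = linfun scaleL \o (fun s : R => s ^+ k).
  by apply/funext => s; rewrite [RHS]lfunE.
have -> : (k%:R * t ^+ k.-1) *: c = linfun scaleL (k%:R * t ^+ k.-1).
  by rewrite lfunE.
have dX : is_derive (t : R^o) (1 : R^o) (fun s => s ^+ k : R^o)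
    (k%:R * t ^+ k.-1 : R^o).
  have := is_deriveX k (is_derive_id (t : R^o) (1 : R^o)).
  by rewrite exprfctE [X in is_derive _ _ _ X]mulr1.
exact: (is_derive_lfun (linfun scaleL) dX).
Qed.

(** The mean value theorem fails for vector-valued functions but holds for each
coordinate in a basis of [Y]. Summing the coordinates gives the inequality up
to a constant that depends on [Y] only, which is enough for estimates of the
form [O(|x|^n)]. *)
Lemma mean_value_inequality (Y : finNormedModType R) :
  exists2 C : R, 0 <= C & forall (h dh : R -> Y) (M : R),
    (forall t : R, is_derive t 1 h (dh t)) ->
    (forall t : R, t \in `]0, 1[ -> `|dh t| <= M) -> `|h 1 - h 0| <= C * M.
Proof.
pose b := vbasis (fullv : {vspace Y}).
pose L i : 'Hom(Y, R^o) := linfun (coord b i).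
exists (\sum_i `|L i| * `|b`_i|).
  by apply: sumr_ge0 => i _; rewrite mulr_ge0.
move=> h dh M hd dhM.
rewrite (coord_vbasis (memvf (h 1 - h 0))) (le_trans (ler_norm_sum _ _ _))//.
rewrite mulr_suml ler_sum// => i _.
rewrite normrZ mulrAC ler_wpM2r//.
have Ld (t : R) : is_derive t 1 (L i \o h) (L i (dh t)).
  exact: is_derive_lfun.
have [|c c01] := @MVT R (L i \o h) (fun t => L i (dh t)) 0 1 ltr01 (fun t _ => Ld t).
  apply: derivable_within_continuous => t _.
  by case: (Ld t).
rewrite subr0 mulr1 /= -linearB => Lc.
have -> : coord b i (h 1 - h 0) = L i (h 1 - h 0) by rewrite lfunE.
by rewrite Lc (le_trans (opnormP _ _))// ler_wpM2l ?opnorm_ge0// dhM.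
Qed.

End differentiation.

Section taylor.
Variables (R : realType) (X : finNormedModType R).

Lemma multihom_diagZ k (Y : finNormedModType R) (t : R) (x : X)
    (T : multihom X k Y) :
  multihom_diag (t *: x) T = t ^+ k *: multihom_diag x T.
Proof.
elim: k Y T => [|k IH] Y T /=; first by rewrite scale1r.
by rewrite IH scale_lfunE linearZ scalerA exprSr.
Qed.

(** The sum stops at degree [n - 1], so that order [0] subtracts nothing and an
induction on the order can start from mere continuity. *)
Definition taylor_remainder n (Y : finNormedModType R) (f : X -> Y) (x : X) :=
  f x - \sum_(k < n) (k`!%:R)^-1 *: multihom_diag x (Diter k f 0).

(** Each homogeneous term contributes [t ^+ k *: c k] along the ray; its
derivative cancels one factor of [k`!], which turns the [k]-th term for [f] into
the term of degree [k - 1] for [Dfun f]. *)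
Lemma is_derive_taylor_remainder n (Y : finNormedModType R) (f : X -> Y)
    (x : X) (t : R) : differentiable f (t *: x) ->
  is_derive t 1 (fun s : R => taylor_remainder n.+1 f (s *: x))
    (taylor_remainder n (Dfun f) (t *: x) x).
Proof.
move=> df; rewrite /taylor_remainder.
rewrite add_lfunE opp_lfunE sum_lfunE.
pose c k := (k`!%:R)^-1 *: multihom_diag x (Diter k f 0).
have -> : (fun s : R => f (s *: x) -
      \sum_(k < n.+1) (k`!%:R)^-1 *: multihom_diag (s *: x) (Diter k f 0)) =
    (fun s => f (s *: x)) - \sum_(k < n.+1) (fun s : R => s ^+ k *: c k).
  apply/funext => s; rewrite !fctE; congr (_ - _).
  rewrite fct_sumE; apply: eq_bigr => k _.
  by rewrite multihom_diagZ /c !scalerA mulrC.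
have dc (k : 'I_n.+1) := is_derive_expZ (c k) k t.
apply: is_derive_eq.
  by apply: is_deriveB; exact: is_derive_ray.
congr (_ - _).
(* The constant term has derivative zero; the others shift down by one. *)
rewrite big_ord_recl /= mul0r scale0r add0r; apply: eq_bigr => k _.
rewrite /bump /= add1n /c scale_lfunE multihom_diagZ !scale_lfunE !scalerA.
congr (_ *: _); rewrite factS natrM invfM mulrACA.
by rewrite divff ?pnatr_eq0// mul1r mulrC.
Qed.

(** The induction replaces [f] by [Dfun f], whose values lie in ['Hom(X, Y)],
hence the quantification over [Y]. *)
Lemma taylor_remainder_bound n (Y : finNormedModType R) (f : X -> Y) :
  isCn n f -> exists C, \forall x \near 0, `|taylor_remainder n f x| <= C * `|x| ^+ n.
Proof.
elim: n Y f => [|n IH] Y f /=.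
  move=> fcont; exists (`|f 0| + 1); near=> x.
  rewrite /taylor_remainder big_ord0 subr0 mulr1.
  (* With nothing subtracted, continuity at [0] bounds [f] by [|f 0| + 1]. *)
  by near: x; apply: (cvgr_norm_le _ (fcont 0)); rewrite ltrDl.
move=> [df /IH [C /nbhs_ballP[r /= r0 HC]]].
have [D D0 mvi] := mean_value_inequality Y.
exists (D * `|C|); apply/nbhs_ballP; exists r => //= x.
rewrite -ball_normE /= sub0r normrN => xr.
have T0 : taylor_remainder n.+1 f (0 *: x) = 0.
  rewrite /taylor_remainder big_ord_recl big1 => [|k _].
    by rewrite addr0 /= fact0 invr1 scale1r scale0r subrr.
  by rewrite multihom_diagZ expr0n scale0r scaler0.
(* The bound by [|C|] rather than [C] keeps the estimate monotone in the norm of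
   the argument: [C] itself may be negative. *)
have := mvi (fun s => taylor_remainder n.+1 f (s *: x)) _ (`|C| * `|x| ^+ n.+1)
  (fun t => is_derive_taylor_remainder n (df (t *: x))).
rewrite T0 subr0 scale1r mulrA; apply => t.
rewrite in_itv /= => /andP[t0 t1].
have tx : `|t *: x| <= `|x|.
  by rewrite normrZ gtr0_norm// ler_piMl// ltW.
rewrite (le_trans (opnormP _ _))// exprSr mulrA ler_wpM2r//.
have /HC /le_trans -> // : ball (0 : X) r (t *: x).
  by rewrite -ball_normE /= sub0r normrN (le_lt_trans tx).
rewrite (le_trans (ler_wpM2r _ (ler_norm C)))// ?exprn_ge0//.
by rewrite ler_wpM2l// lerXn2r ?nnegrE.
Unshelve. all: by end_near. Qed.

Lemma taylor_bound n (Y : finNormedModType R) (f : X -> Y) :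
  (0 < n)%N -> isCn n f ->
  exists C, \forall x \near 0, `|f x - taylor n.-1 f x| <= C * `|x| ^+ n.
Proof. by case: n => // n _; exact: taylor_remainder_bound. Qed.

End taylor.

Theorem proposition2p4 (R : realType) (n : nat) (hn : (2 <= n)%N)
    (X : finNormedModType R) (Xc Xu Xs : {vspace X}) (A : 'End(X))
    (hA : center_splitting n A Xc Xu Xs) :
  exists2 delta : R, 0 < delta &
  forall (Lg Lc : R), 0 < Lg <= delta -> 0 < Lc <= delta ->
  forall (F g : X -> X),
    (forall x, F x = A x + g x) -> isCn n F ->
    isCnb n g -> g 0 = 0 -> Dfun g 0 = 0 -> (Dnorm0 g < Lg%:E)%E ->
  forall (kc : subvs_of Xc -> subvs_of Xc),
    isCnb n kc -> kc 0 = 0 -> Dfun kc 0 = 0 -> (Dnorm0 kc < Lc%:E)%E ->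
  forall (K : subvs_of Xc -> X) (Rc : subvs_of Xc -> subvs_of Xc),
    center_conjugacy n A Xu Xs F kc K Rc ->
  exists2 calU : set (subvs_of Xc), nbhs 0 calU &
  forall U : set (subvs_of Xc), nbhs 0 U -> U `<=` calU ->
  exists CR CK : R, forall x, U x ->
    `|Rc x - taylor n.-1 Rc x| <= CR * `|x| ^+ n /\
    `|K x - taylor n.-1 K x| <= CK * `|x| ^+ n.
Proof.
exists 1 => // Lg Lc _ _ F g _ _ _ _ _ _ kc _ _ _ _ K Rc [K_Cn Rc_Cn _ _ _ _].
have n0 : (0 < n)%N by exact: ltnW.
have [CR HR] := taylor_bound n0 Rc_Cn.
have [CK HK] := taylor_bound n0 K_Cn.
exists [set x | `|Rc x - taylor n.-1 Rc x| <= CR * `|x| ^+ n /\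
                `|K x - taylor n.-1 K x| <= CK * `|x| ^+ n].
  by near=> x; split; near: x.
by move=> U _ UcalU; exists CR, CK; exact: UcalU.
Unshelve. all: by end_near. Qed.
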